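(* Let $P=P^X$ be a probability measure over $\mathbb{R}^k$ and fix $\theta\in\mathbb{R}^k$. Then: (i) $V\mapsto D_\theta(V,P)$ is quasi-concave, that is, $D_\theta(V_t,P)\geq\min\{D_\theta(V_a,P),D_\theta(V_b,P)\}$ for $V_t=(1-t)V_a+tV_b$, for all $V_a,V_b\in\mathcal{P}_{k,\mathrm{tr}}$ and all $t\in[0,1]$; (ii) the region $R_\theta(\alpha,P)=\{V\in\mathcal{P}_{k,\mathrm{tr}}: D_\theta(V,P)\geq\alpha\}$ is convex for any $\alpha\geq 0$.
   Context: $P=P^X$ denotes the distribution of a random $k$-vector $X$, and $\mathrm{pr}$ denotes probability under $P$. $\mathcal{P}_k$ is the set of $k\times k$ real symmetric positive definite matrices, $A^{1/2}$ is the unique square root of $A\in\mathcal{P}_k$ in $\mathcal{P}_k$, $A^{-1/2}$ is the inverse of $A^{1/2}$, and $\mathcal{P}_{k,\mathrm{tr}}=\{V\in\mathcal{P}_k:\mathrm{tr}(V)=k\}$ is the set of shape matrices. $\mathcal{S}^{m-1}$ is the unit sphere of $\mathbb{R}^m$. For $V\in\mathcal{P}_{k,\mathrm{tr}}$, let $U_{\theta,V}=V^{-1/2}(X-\theta)/\|V^{-1/2}(X-\theta)\|$ if $X\neq\theta$ and $U_{\theta,V}=0$ otherwise, and let $W_{\theta,V}=\mathrm{vec}\{U_{\theta,V}U_{\theta,V}^T-(1/k)I_k\}\in\mathbb{R}^{k^2}$, where $\mathrm{vec}$ stacks the columns of a matrix. The fixed-$\theta$ (Tyler) shape depth of $V$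 with respect to $P$ is $$D_\theta(V,P)=\inf_{u\in\mathcal{S}^{k^2-1}}\mathrm{pr}(u^T W_{\theta,V}\geq 0).$$ *)

(* Defs.v *)
From mathcomp Require Export all_boot all_order all_algebra.
From mathcomp Require Export all_classical all_reals all_analysis.

Set Implicit Arguments.
Unset Strict Implicit.
Unset Printing Implicit Defensive.

Export Order.TTheory GRing.Theory Num.Theory.
Export numFieldNormedType.Exports.

Local Open Scope classical_set_scope.
Local Open Scope ring_scope.

(* R^k with its Borel sigma-algebra, for the usual topology. *)
Definition borel_cV (R : realType) (k : nat) :=
  g_sigma_algebraType (@open 'cV[R]_k).

(* The norm `|x| of the library is the sup norm on matrices. *)
Definition norm2 (R : realType) (m : nat) (x : 'cV[R]_m) : R :=
  Num.sqrt (\sum_i x i 0 ^+ 2).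

Definition sphere (R : realType) (m : nat) : set 'cV[R]_m :=
  [set u | norm2 u = 1].

Definition posdefmx (R : realType) (k : nat) : set 'M[R]_k :=
  [set A | A \is symmetricmx /\
           forall x : 'cV[R]_k, x != 0 -> 0 < (x^T *m A *m x) 0 0].

Definition shapemx (R : realType) (k : nat) : set 'M[R]_k :=
  [set V | posdefmx V /\ \tr V = k%:R].

(* The default value 0 is never reached on [posdefmx], where the square root
   in [posdefmx] exists and is unique. *)
Definition sqrtmx (R : realType) (k : nat) (A : 'M[R]_k) : 'M[R]_k :=
  xget 0 [set B | posdefmx B /\ B *m B = A].

(* [mxvec] reads a matrix row by row, hence the transpose. *)
Definition vec (R : realType) (m n : nat) (A : 'M[R]_(m, n)) : 'cV[R]_(n * m) :=
  (mxvec A^T)^T.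

Definition std_sign (R : realType) (k : nat) (theta : 'cV[R]_k) (V : 'M[R]_k)
    (x : 'cV[R]_k) : 'cV[R]_k :=
  let y := invmx (sqrtmx V) *m (x - theta) in
  if x == theta then 0 else (norm2 y)^-1 *: y.

Definition sign_cov (R : realType) (k : nat) (theta : 'cV[R]_k) (V : 'M[R]_k)
    (x : 'cV[R]_k) : 'cV[R]_(k * k) :=
  let U := std_sign theta V x in
  vec (U *m U^T - k%:R^-1 *: 1%:M).

Definition shape_depth (R : realType) (k : nat) (theta : 'cV[R]_k)
    (V : 'M[R]_k) (P : probability (borel_cV R k) R) : \bar R :=
  ereal_inf [set P [set x | 0 <= (u^T *m sign_cov theta V x) 0 0]
            | u in @sphere R (k * k)].

Definition shape_region (R : realType) (k : nat) (theta : 'cV[R]_k)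
    (alpha : R) (P : probability (borel_cV R k) R) : set 'M[R]_k :=
  [set V | shapemx V /\ (alpha%:E <= shape_depth theta V P)%E].

(* Main.v *)
Require Import Defs.
From mathcomp Require Import lra.
From mathcomp.real_closed Require Import complex.

(** Write [S] for the positive definite square root of [V].  For [x != theta]
and a direction [u] equal to the vectorisation of a matrix [M], the number
[u^T W] has the sign of [z^T B z], where [z = x - theta] and
[B = S^-1 (M - (tr M / k) I) S^-1] satisfies [tr (B V) = 0]; at [x = theta] it
has the sign of [- tr M].  Every event in the definition of the depth of [V]
therefore contains a quadratic event [x != theta /\ 0 <= z^T B z] with
[tr (B V) = 0] (see [tr_pullback_mx] and [sign_cov_eventE]).

Conversely, the depth of [V] is at most the probability of the quadratic event
of any [B] with [0 <= tr (B V)] (see [shape_depth_le]).  Indeed the matrix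
[M = S B S + I] has positive trace, so the event of its direction leaves
[theta] out, and it is the quadratic event of
[B - (tr (B V) / k) V^-1], which is smaller than that of [B] because [V^-1] is
positive definite.

Quasi-concavity follows: if [tr (B V_t) = 0] with [V_t] a convex combination
of [V_a] and [V_b], then [tr (B V_a)] and [tr (B V_b)] are not both negative,
so the probability of the quadratic event of [B] bounds the depth of [V_a] or
that of [V_b] from above.  Convexity of the regions is then immediate, shape
matrices being stable under convex combinations.

The square root has to be shown to exist.  A real symmetric matrix is
diagonalised over the complex numbers with real eigenvalues, so every real
polynomial vanishing on its spectrum annihilates it.  Interpolating the fourth
root on the spectrum gives a symmetric matrix [T] that is a polynomial in [V]
and satisfies [T^4 = V]; then [S = T^2 = T^T T] is positive definite. *)

Set Implicit Arguments.
Unset Strict Implicit.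
Unset Printing Implicit Defensive.

Local Open Scope classical_set_scope.
Local Open Scope ring_scope.

(** * Square roots of positive definite matrices *)

Lemma poly_interpolation (F : fieldType) (f : F -> F) (s : seq F) :
  exists q : {poly F}, {in s, forall a, q.[a] = f a}.
Proof.
elim: s => [|b s [q qE]]; first by exists 0.
have [bs|bNs] := boolP (b \in s).
  by exists q => a; rewrite inE => /predU1P[->|]; exact: qE.
pose p := \prod_(a <- s) ('X - a%:P).
have pb : p.[b] != 0 by rewrite -[_ == _]/(root p b) root_prod_XsubC.
exists (q + ((f b - q.[b]) / p.[b])%:P * p) => a; rewrite inE !hornerE.
move=> /predU1P[->|sa]; first by rewrite divfK// addrC subrK.
have /rootP -> : root p a by rewrite root_prod_XsubC.
by rewrite mulr0 addr0 qE.
Qed.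

Lemma mul_tr_self_gt0 (R : realFieldType) (k : nat) (x : 'cV[R]_k) :
  x != 0 -> 0 < (x^T *m x) 0 0.
Proof.
move=> x0; rewrite mxE lt_neqAle sumr_ge0 ?andbT; last first.
  by move=> i _; rewrite mxE -expr2 sqr_ge0.
apply: contra x0; rewrite eq_sym psumr_eq0; last first.
  by move=> i _; rewrite mxE -expr2 sqr_ge0.
move=> /allP h; apply/eqP/colP => i; rewrite [RHS]mxE.
have := h i; rewrite mem_index_enum mxE => /(_ isT).
by rewrite mulf_eq0 orbb => /eqP.
Qed.

Lemma symmetricmxP (R : realType) (k : nat) (A : 'M[R]_k) :
  reflect (A^T = A) (A \is symmetricmx).
Proof.
apply: (iffP idP) => [/is_hermitianmxP|h].
  by rewrite expr0 scale1r map_mx_id.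
by apply/is_hermitianmxP; rewrite expr0 scale1r map_mx_id.
Qed.

Lemma posdefmx_eigenvalue_gt0 (R : realType) (k : nat) (V : 'M[R]_k) a :
  posdefmx V -> eigenvalue V a -> 0 < a.
Proof.
move=> [_ Vpos] /eigenvalueP[v vV v0].
have w0 : v^T != 0 by rewrite trmx_eq0.
have := Vpos _ w0; rewrite trmxK vV -scalemxAl mxE.
have := mul_tr_self_gt0 w0; rewrite trmxK => vv.
by rewrite pmulr_lgt0.
Qed.

(** The spectral theorem, in the form of an annihilation criterion over the
reals: a polynomial that vanishes at the eigenvalues [r] annihilates [V]. *)
Lemma symmetricmx_real_spectrum (R : realType) (k : nat) (V : 'M[R]_k.+1) :
  V^T = V -> exists r : 'I_k.+1 -> R, (forall i, eigenvalue V (r i)) /\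
    forall p, (forall i, root p (r i)) -> horner_mx V p = 0.
Proof.
move=> Vsym; pose toC := real_complex R; pose A := map_mx toC V.
have Areal : A \is a realmx.
  by apply/mxOverP => i j; rewrite mxE complex_real.
have Asym : A \is symmetricmx.
  by apply/is_hermitianmxP; rewrite expr0 scale1r map_mx_id// map_trmx Vsym.
have /orthomx_spectralP AE := symmetric_normalmx Asym Areal.
have dreal := hermitian_spectral_diag_real (realsym_hermsym Asym Areal).
set Q := spectralmx A in AE *; set d := spectral_diag A in AE dreal *.
have Qu : Q \in unitmx by exact: spectral_unit.
have dRe i : d 0 i = toC (complex.Re (d 0 i)).
  by rewrite /toC RRe_real//; exact/mxOverP.
exists (fun i => complex.Re (d 0 i)); split=> [i|p pr].
  rewrite -(eigenvalue_map toC) -/A -[X in eigenvalue _ X]dRe AE.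
  apply/eigenvalueP; exists (row i Q).
    rewrite -row_mul mulmxA mulmxA mulmxV// mul1mx row_mul.
    by rewrite row_diag_mx -scalemxAl -rowE.
  (* A zero row would contradict the invertibility of [Q]. *)
  apply: contraTneq isT => Qi0.
  have : delta_mx 0 i = 0 :> 'rV[R[i]]_k.+1.
    by rewrite -[LHS](mulmxK Qu) -rowE Qi0 mul0mx.
  by move=> /rowP/(_ i)/eqP; rewrite !mxE !eqxx oner_eq0.
apply: (map_mx_inj (f := toC)).
rewrite map_mx0 map_horner_mx -/A AE.
rewrite horner_mx_uconjC// horner_mx_diag.
suff -> : map_mx (horner (map_poly toC p)) d = 0.
  by rewrite linear0 mulmx0 mul0mx.
apply/rowP => i; rewrite !mxE.
by rewrite dRe (horner_map toC) /= (rootP (pr _)) rmorph0.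
Qed.

Lemma trmx_horner_mx (R : comNzRingType) (k : nat) (A : 'M[R]_k.+1) p :
  (horner_mx A p)^T = horner_mx A^T p.
Proof.
elim/poly_ind: p => [|p c IHp]; first by rewrite !rmorph0 trmx0.
rewrite !rmorphD !rmorphM /= !horner_mx_X !horner_mx_C linearD/= tr_scalar_mx.
rewrite -!mulmxE trmx_mul IHp; congr (_ + _).
exact/comm_mx_horner.
Qed.

(** The square root is unique as well, but only its existence is used. *)
Lemma posdefmx_sqrtmx_exists (R : realType) (k : nat) (V : 'M[R]_k) :
  posdefmx V -> exists S : 'M[R]_k, posdefmx S /\ S *m S = V.
Proof.
case: k V => [|k] V Vpos.
  by exists V; split=> //; rewrite !flatmx0.
have Vsym : V^T = V by apply/symmetricmxP; case: Vpos.
have [r [rV Vr]] := symmetricmx_real_spectrum Vsym.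
have [q qE] :=
  poly_interpolation (fun a : R => Num.sqrt (Num.sqrt a)) (codom r).
(* A fourth root of [V], so that its square is visibly positive definite. *)
pose T := horner_mx V q.
have TE : T *m T *m (T *m T) = V.
  rewrite !mulmxE -!rmorphM /=; apply/eqP; rewrite -subr_eq0.
  rewrite -[X in _ - X](horner_mx_X V) -rmorphB/=; apply/eqP.
  apply: Vr => i; apply/rootP.
  have a0 := posdefmx_eigenvalue_gt0 Vpos (rV i).
  have sqrtK (b : R) : 0 <= b -> Num.sqrt b * Num.sqrt b = b.
    by move=> b0; rewrite -expr2 sqr_sqrtr.
  by rewrite !hornerE qE ?codom_f//= -mulrA !sqrtK ?subrr ?sqrtr_ge0// ltW.
have Tsym : T^T = T by rewrite trmx_horner_mx Vsym.
exists (T *m T); split=> //; split.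
  by apply/symmetricmxP; rewrite trmx_mul Tsym.
move=> x x0; rewrite -{1}Tsym mulmxA -trmx_mul -mulmxA.
apply: mul_tr_self_gt0; apply: contra_neq x0 => Tx.
have [_ Vgt] := Vpos; apply/eqP/negP => /negP /Vgt.
by rewrite -TE -!mulmxA Tx !mulmx0 mxE ltxx.
Qed.

(** * Quadratic forms *)

(** The quadratic form [z^T B z]; [B] need not be symmetric. *)
Definition quad_form (R : realType) (k : nat) (B : 'M[R]_k)
    (z : 'cV[R]_k) : R :=
  (z^T *m B *m z) 0 0.

Lemma quad_formD (R : realType) (k : nat) (A B : 'M[R]_k) z :
  quad_form (A + B) z = quad_form A z + quad_form B z.
Proof. by rewrite /quad_form mulmxDr mulmxDl [LHS]mxE. Qed.

Lemma quad_formZ (R : realType) (k : nat) c (A : 'M[R]_k) z :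
  quad_form (c *: A) z = c * quad_form A z.
Proof. by rewrite /quad_form -scalemxAr -scalemxAl [LHS]mxE. Qed.

Lemma quad_formZr (R : realType) (k : nat) c (A : 'M[R]_k) z :
  quad_form A (c *: z) = c ^+ 2 * quad_form A z.
Proof.
rewrite /quad_form [(c *: z)^T]linearZ/= -!scalemxAl -scalemxAr scalerA.
by rewrite [LHS]mxE expr2.
Qed.

Lemma quad_formB (R : realType) (k : nat) (A B : 'M[R]_k) z :
  quad_form (A - B) z = quad_form A z - quad_form B z.
Proof. by rewrite quad_formD -scaleN1r quad_formZ mulN1r. Qed.

Lemma quad_form_conj (R : realType) (k : nat) (A B : 'M[R]_k) z :
  quad_form B (A *m z) = quad_form (A^T *m B *m A) z.
Proof. by rewrite /quad_form trmx_mul !mulmxA. Qed.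

(** * Positive definite matrices and the Euclidean norm *)

Lemma posdefmx_unit (R : realType) (k : nat) (V : 'M[R]_k) :
  posdefmx V -> V \in unitmx.
Proof.
move=> [_ Vpos]; rewrite -unitmx_tr -row_free_unit -kermx_eq0.
apply/rowV0P => v /sub_kermxP vV; apply/eqP/negPn/negP => v0.
have := Vpos v^T; rewrite trmx_eq0 => /(_ v0).
by rewrite -mulmxA -[V *m _]trmxK trmx_mul trmxK vV trmx0 mulmx0 mxE ltxx.
Qed.

Lemma posdefmx_convex (R : realType) (k : nat) (A B : 'M[R]_k) (t : R) :
  0 <= t <= 1 -> posdefmx A -> posdefmx B -> posdefmx ((1 - t) *: A + t *: B).
Proof.
move=> /andP[t0 t1] [/symmetricmxP As Ap] [/symmetricmxP Bs Bp]; split.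
  by apply/symmetricmxP; rewrite linearD !linearZ/= As Bs.
move=> x x0; rewrite -/(quad_form _ x) quad_formD !quad_formZ.
have := Ap _ x0; have := Bp _ x0; rewrite -!/(quad_form _ x) => b0 a0.
have [->|tn0] := eqVneq t 0; first by rewrite subr0 mul1r mul0r addr0.
rewrite ltr_wpDl ?mulr_ge0 ?subr_ge0 ?(ltW a0)// mulr_gt0//.
by rewrite lt_neqAle eq_sym tn0.
Qed.

Lemma sqrtmxP (R : realType) (k : nat) (V : 'M[R]_k) : posdefmx V ->
  posdefmx (sqrtmx V) /\ sqrtmx V *m sqrtmx V = V.
Proof.
move=> /posdefmx_sqrtmx_exists.
exact: (@xgetPex _ 0 [set B | posdefmx B /\ B *m B = V]).
Qed.

Lemma norm2_sqr (R : realType) (m : nat) (x : 'cV[R]_m) :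
  norm2 x ^+ 2 = (x^T *m x) 0 0.
Proof.
rewrite sqr_sqrtr; last by apply: sumr_ge0 => i _; exact: sqr_ge0.
by rewrite mxE; apply: eq_bigr => i _; rewrite mxE expr2.
Qed.

Lemma quad_form1 (R : realType) (m : nat) (x : 'cV[R]_m) :
  quad_form 1%:M x = norm2 x ^+ 2.
Proof. by rewrite norm2_sqr /quad_form mulmx1. Qed.

Lemma norm2_ge0 (R : realType) (m : nat) (x : 'cV[R]_m) : 0 <= norm2 x.
Proof. exact: sqrtr_ge0. Qed.

Lemma norm2_gt0 (R : realType) (m : nat) (x : 'cV[R]_m) : x != 0 -> 0 < norm2 x.
Proof.
move=> x0; rewrite lt_neqAle norm2_ge0 andbT eq_sym -sqrf_eq0 norm2_sqr.
by rewrite gt_eqF// mul_tr_self_gt0.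
Qed.

Lemma norm2Z (R : realType) (m : nat) (c : R) (x : 'cV[R]_m) :
  norm2 (c *: x) = `|c| * norm2 x.
Proof.
apply/eqP; rewrite -(@eqrXn2 _ 2%N)// ?mulr_ge0 ?norm2_ge0//.
by rewrite exprMn -!quad_form1 quad_formZr real_normK ?num_real.
Qed.

(** Vectorisation carries the trace form to the dot product. *)
Lemma mxvec_dot (R : comNzRingType) (m n : nat) (A B : 'M[R]_(m, n)) :
  (mxvec A *m (mxvec B)^T) 0 0 = \tr (A *m B^T).
Proof.
rewrite mxE (reindex _ (curry_mxvec_bij _ _)) /=.
transitivity (\sum_i \sum_j A i j * B i j).
  by rewrite pair_bigA; apply: eq_bigr => -[i j] _ /=; rewrite !(mxE, mxvecE).
by apply: eq_bigr => i _; rewrite mxE; apply: eq_bigr => j _; rewrite !mxE.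
Qed.

(** * Quadratic events *)

(** The set of the points other than [theta] where the quadratic form of [B]
centred at [theta] is nonnegative.  Leaving [theta] out matters, as its
probability may be positive. *)
Definition quad_event (R : realType) (k : nat) (theta : 'cV[R]_k)
    (B : 'M[R]_k) : set (borel_cV R k) :=
  [set x | x != theta /\ 0 <= quad_form B (x - theta)].

Lemma continuous_quad_form (R : realType) (k : nat) (B : 'M[R]_k)
  (theta : 'cV[R]_k) : continuous (fun x : 'cV[R]_k => quad_form B (x - theta)).
Proof.
have -> : (fun x : 'cV[R]_k => quad_form B (x - theta)) = fun x =>
    \sum_i (\sum_j (x j 0 - theta j 0) * B j i) * (x i 0 - theta i 0).
  apply/funext => x; rewrite /quad_form mxE; apply: eq_bigr => i _.
  by rewrite !mxE; congr (_ * _); apply: eq_bigr => j _; rewrite !mxE.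
have ccoord i : continuous (fun x : 'cV[R]_k => x i 0 - theta i 0).
  move=> x; apply: continuousB; last exact: cst_continuous.
  exact: coord_continuous.
have contM (f g : 'cV[R]_k -> R) : continuous f -> continuous g ->
    continuous (fun x => f x * g x).
  by move=> cf cg x; apply: continuousM; [exact: cf|exact: cg].
apply: continuous_big => [|i _]; first exact: add_continuous.
apply: (contM); last exact: ccoord.
apply: continuous_big => [|j _]; first exact: add_continuous.
by apply: (contM); [exact: ccoord|exact: cst_continuous].
Qed.

Lemma neq_center_quad_form (R : realType) (k : nat) (theta x : 'cV[R]_k) :
  (x != theta) = (0 < quad_form 1%:M (x - theta)).
Proof.
rewrite /quad_form mulmx1 -subr_eq0; have [->|/mul_tr_self_gt0->//] := eqVneq.
by rewrite mulmx0 mxE ltxx.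
Qed.

Lemma measurable_neq_center (R : realType) (k : nat) (theta : 'cV[R]_k) :
  measurable ([set x | x != theta] : set (borel_cV R k)).
Proof.
apply: sub_sigma_algebra.
have -> : [set x | x != theta] =
    (fun x : 'cV[R]_k => quad_form 1%:M (x - theta)) @^-1` [set y | 0 < y].
  by apply/seteqP; split=> x; rewrite /= neq_center_quad_form.
apply: open_comp; last exact: open_gt.
by move=> x _; exact: continuous_quad_form.
Qed.

Lemma measurable_quad_event (R : realType) (k : nat) (theta : 'cV[R]_k) B :
  measurable (quad_event theta B).
Proof.
have -> : quad_event theta B =
    [set x | x != theta] `\` [set x | quad_form B (x - theta) < 0].
  apply/seteqP; split=> x [/= xt].
    by rewrite leNgt => /negP.
  by move=> /negP; rewrite -leNgt.
apply: measurableD; first exact: measurable_neq_center.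
apply: sub_sigma_algebra.
apply: (@open_comp _ _ (fun x : 'cV[R]_k => quad_form B (x - theta))
  [set y | y < 0]); last exact: open_lt.
by move=> x _; exact: continuous_quad_form.
Qed.

(** * The depth in terms of quadratic events *)

Section sign_cov.
Variables (R : realType) (k : nat) (theta : 'cV[R]_k) (V : 'M[R]_k).
Hypotheses (k0 : (0 < k)%N) (Vpos : posdefmx V).
Let S := sqrtmx V.

Let Sunit : S \in unitmx.
Proof. by have [/posdefmx_unit] := sqrtmxP Vpos. Qed.

Let Ssym : S^T = S.
Proof. by have [[/symmetricmxP]] := sqrtmxP Vpos. Qed.

Let SSV : S *m S = V.
Proof. by have [] := sqrtmxP Vpos. Qed.

Lemma sign_covE M x : (mxvec M *m sign_cov theta V x) 0 0 =
  quad_form M (std_sign theta V x) - \tr M / k%:R.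
Proof.
rewrite /sign_cov /vec mxvec_dot trmxK mulmxBr mxtraceD linearN/=.
rewrite mulmxA mxtrace_mulC mulmxA /quad_form -trace_mx11; congr (_ - _).
by rewrite -scalemxAr mulmx1 mxtraceZ mulrC.
Qed.

Lemma sign_cov_ge0_center M :
  (0 <= (mxvec M *m sign_cov theta V theta) 0 0) = (\tr M <= 0).
Proof.
rewrite sign_covE /std_sign eqxx /quad_form mulmx0 mxE sub0r oppr_ge0.
by rewrite pmulr_lle0// invr_gt0 ltr0n.
Qed.

(** The matrix of the quadratic form in [x - theta] whose sign is that of the
product of the sign covariance with [mxvec M], away from [theta]. *)
Definition pullback_mx (M : 'M[R]_k) : 'M[R]_k :=
  invmx S *m (M - (\tr M / k%:R)%:M) *m invmx S.

Lemma sign_cov_ge0 M x : x != theta ->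
  (0 <= (mxvec M *m sign_cov theta V x) 0 0) =
  (0 <= quad_form (pullback_mx M) (x - theta)).
Proof.
move=> xt; rewrite sign_covE /std_sign (negPf xt).
set y := invmx S *m (x - theta).
have y0 : 0 < norm2 y.
  apply: norm2_gt0; apply: contra xt => /eqP y0.
  by rewrite -subr_eq0 -(mulKVmx Sunit (x - theta)) -/y y0 mulmx0.
rewrite /pullback_mx -{1}Ssym -trmx_inv -quad_form_conj -/y.
rewrite quad_formB -[(\tr M / k%:R)%:M]scalemx1 quad_formZ quad_form1.
rewrite quad_formZr exprVn.
rewrite -[RHS](@pmulr_rge0 _ (norm2 y ^+ 2)^-1) ?invr_gt0 ?exprn_gt0//.
rewrite mulrBr [X in _ = (_ <= _ - X)]mulrCA mulVf ?mulr1//.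
by rewrite expf_neq0// gt_eqF.
Qed.

Lemma tr_pullback_mx M : \tr (pullback_mx M *m V) = 0.
Proof.
rewrite /pullback_mx -SSV mulmxA mulmxKV// -mulmxA mxtrace_mulC mulmxK//.
rewrite mxtraceD linearN/= mxtrace_scalar -[X in _ - X]mulr_natr.
by rewrite divfK ?subrr// pnatr_eq0 -lt0n.
Qed.

(** The point [theta] itself is in the event exactly when [\tr M <= 0]. *)
Lemma sign_cov_eventE M :
  [set x | 0 <= (mxvec M *m sign_cov theta V x) 0 0] =
  quad_event theta (pullback_mx M) `|`
    (if \tr M <= 0 then ~` [set x | x != theta] else set0).
Proof.
apply/seteqP; split=> x /=.
  have [->|xt] := eqVneq x theta.
    by rewrite sign_cov_ge0_center => ->; right; rewrite /= eqxx.
  by rewrite sign_cov_ge0//; left.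
move=> [[xt]|]; first by rewrite sign_cov_ge0.
case: ifPn => // trM /negP; rewrite negbK => /eqP ->.
by rewrite sign_cov_ge0_center.
Qed.

Lemma measurable_sign_cov_event M :
  measurable ([set x | 0 <= (mxvec M *m sign_cov theta V x) 0 0]
              : set (borel_cV R k)).
Proof.
rewrite sign_cov_eventE; apply: measurableU; first exact: measurable_quad_event.
by case: ifP => // _; apply: measurableC; exact: measurable_neq_center.
Qed.

Variable P : probability (borel_cV R k) R.

(** The condition on [B] is an inequality, which is what lets one [B] serve for
several [V]. *)
Lemma shape_depth_le B : 0 <= \tr (B *m V) ->
  (shape_depth theta V P <= P (quad_event theta B))%E.
Proof.
(* Adding [1%:M] makes the trace positive and [M] nonzero, without changing
   the trace-free part of [M]. *)
move=> trB; pose M := S *m B *m S + 1%:M.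
have trSBS : \tr (S *m B *m S) = \tr (B *m V).
  by rewrite -mulmxA mxtrace_mulC -mulmxA SSV.
have trM : 0 < \tr M.
  by rewrite mxtraceD trSBS mxtrace1 ltr_wpDl// ltr0n.
have M0 : (mxvec M)^T != 0.
  rewrite trmx_eq0 mxvec_eq0; apply: contraTneq trM => ->.
  by rewrite mxtrace0 ltxx.
pose c := (norm2 (mxvec M)^T)^-1.
have c0 : 0 < c by rewrite invr_gt0 norm2_gt0.
apply: (@le_trans _ _
    (P [set x | 0 <= (mxvec (c *: M) *m sign_cov theta V x) 0 0])).
  apply: ereal_inf_lbound; exists (mxvec (c *: M))^T; last by rewrite trmxK.
  by rewrite /sphere/= !linearZ/= norm2Z gtr0_norm// mulVf// gt_eqF// norm2_gt0.
apply: le_measure; rewrite ?inE; first exact: measurable_sign_cov_event.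
  exact: measurable_quad_event.
(* The trace is positive, so [theta] is not in the event. *)
rewrite sign_cov_eventE mxtraceZ leNgt mulr_gt0//= setU0.
move=> x [xt qx]; split=> //; move: qx.
have k0R : k%:R != 0 :> R by rewrite pnatr_eq0 -lt0n.
have -> : pullback_mx (c *: M) =
    c *: (B - (\tr (B *m V) / k%:R) *: (invmx S *m invmx S)).
  rewrite /pullback_mx mxtraceZ -mulrA -scale_scalar_mx -scalerBr.
  rewrite -scalemxAr -scalemxAl; congr (_ *: _).
  rewrite mxtraceD trSBS mxtrace1 mulrDl divff//; set a := _ / _.
  have -> : (a + 1)%:M = a%:M + 1%:M :> 'M[R]_k.
    by apply/matrixP => i j; rewrite !mxE mulrnDl.
  rewrite opprD addrACA subrr addr0 mulmxBr mulmxBl !mulmxA mulVmx//.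
  rewrite mul1mx mulmxK//.
  by rewrite -[in LHS]scalemx1 -scalemxAr -scalemxAl mulmx1.
rewrite quad_formZ pmulr_rge0// quad_formB quad_formZ subr_ge0.
apply: le_trans; apply: mulr_ge0; first by rewrite divr_ge0.
rewrite -[invmx S as X in X *m _]mulmx1 -{1}Ssym -trmx_inv -quad_form_conj.
by rewrite quad_form1 sqr_ge0.
Qed.
End sign_cov.

Theorem theorem3p4 (R : realType) (k : nat) (hk : (0 < k)%N)
    (P : probability (borel_cV R k) R) (theta : 'cV[R]_k) :
  (forall Va Vb : 'M[R]_k, shapemx Va -> shapemx Vb ->
    forall t : R, 0 <= t <= 1 ->
    (Order.min (shape_depth theta Va P) (shape_depth theta Vb P)
       <= shape_depth theta ((1 - t) *: Va + t *: Vb) P)%E) /\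
  (forall alpha : R, 0 <= alpha -> convex_set (shape_region theta alpha P)).
Proof.
have quasi_concave (Va Vb : 'M[R]_k) : shapemx Va -> shapemx Vb ->
    forall t : R, 0 <= t <= 1 ->
    (Order.min (shape_depth theta Va P) (shape_depth theta Vb P)
       <= shape_depth theta ((1 - t) *: Va + t *: Vb) P)%E.
  move=> [Vap _] [Vbp _] t t01; set V := (1 - t) *: Va + t *: Vb.
  have Vp : posdefmx V by exact: posdefmx_convex.
  apply: le_ereal_inf_tmp => _ [u _ <-].
  have -> : u^T = mxvec (vec_mx u^T : 'M[R]_k) by rewrite vec_mxK.
  set M := vec_mx _; set B := pullback_mx V M.
  apply: (@le_trans _ _ (P (quad_event theta B))); last first.
    apply: le_measure; rewrite ?inE; first exact: measurable_quad_event.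
      exact: measurable_sign_cov_event.
    by rewrite sign_cov_eventE//; exact: subsetUl.
  have trB : (1 - t) * \tr (B *m Va) + t * \tr (B *m Vb) = 0.
    by rewrite -!mxtraceZ -mxtraceD !scalemxAr -mulmxDr tr_pullback_mx.
  have [trBa|trBa] := leP 0 (\tr (B *m Va)).
    apply: (@le_trans _ _ (shape_depth theta Va P)); last first.
      exact: shape_depth_le.
    move: (shape_depth _ Va _) (shape_depth _ Vb _) => a b.
    by rewrite ge_min lexx.
  have [trBb|trBb] := leP 0 (\tr (B *m Vb)).
    apply: (@le_trans _ _ (shape_depth theta Vb P)); last first.
      exact: shape_depth_le.
    move: (shape_depth _ Va _) (shape_depth _ Vb _) => a b.
    by rewrite ge_min lexx orbT.
  (* Both traces negative would make their convex combination negative. *)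
  case/andP: t01 => t0 t1; exfalso; nra.
split; first exact: quasi_concave.
move=> alpha _ Va Vb t /set_mem[[Vap tra] Da] /set_mem[[Vbp trb] Db].
apply/mem_set.
(* In [conv t Va Vb] the weight [t] is that of [Va]. *)
have t01 : 0 <= 1 - t%:num <= 1.
  by rewrite subr_ge0 gerBl ge0 le1.
have -> : conv t Va Vb = (1 - (1 - t%:num)) *: Va + (1 - t%:num) *: Vb.
  by rewrite subKr.
split; last first.
  apply: (@le_trans _ _ (Order.min (shape_depth theta Va P)
                                   (shape_depth theta Vb P))).
    by rewrite le_min; apply/andP; split; [exact: Da|exact: Db].
  exact: quasi_concave.
split; first exact: posdefmx_convex.
by rewrite mxtraceD !mxtraceZ tra trb -mulrDl subrK mul1r.
Qed.
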